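(* The set $\mathbf{FBP}$ of finite Blaschke products is a closed subset (for the supremum norm) of $\mathbf{B}_{\mathcal{A}}$, and hence also a closed subset of $\mathbf{B}_{H^\infty}$.
   Context: $\mathbb{D}$ is the open unit disc in $\mathbb{C}$. $H^\infty$ is the Banach space of bounded holomorphic functions on $\mathbb{D}$ with norm $\|f\|_\infty=\sup_{z\in\mathbb{D}}|f(z)|$. The disc algebra $\mathcal{A}$ is the space of continuous functions on $\overline{\mathbb{D}}$ that are holomorphic in $\mathbb{D}$, with the same norm (it is regarded as a closed subspace of $H^\infty$ by restriction to $\mathbb{D}$). For a Banach space $X$, $\mathbf{B}_X=\{x\in X:\|x\|\le 1\}$ is its closed unit ball. A finite Blaschke product is a function of the form $B(z)=c\prod_{k=1}^n\frac{a_k-z}{1-\overline{a}_k z}$ with $n\ge 0$, $a_1,\dots,a_n\in\mathbb{D}$ and $c\in\mathbb{C}$, $|c|=1$ (unimodular constants, $n=0$, are included). *)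

(* Defs.v *)
From HB Require Import structures.
From mathcomp Require Import all_boot all_order all_algebra.
From mathcomp Require Import all_classical all_reals all_analysis.
From mathcomp Require Import complex.

Set Implicit Arguments.
Unset Strict Implicit.
Unset Printing Implicit Defensive.

Import Order.TTheory GRing.Theory Num.Theory.
Import numFieldNormedType.Exports.

Local Open Scope classical_set_scope.
Local Open Scope complex_scope.
Local Open Scope ring_scope.

(* [R[i]] as a one-dimensional normed space over itself; its norm [`|z|] and
   hence the norms below take their values in the nonnegative reals seen
   inside [R[i]]. *)
HB.instance Definition _ (R : rcfType) := NormedModule.copy R[i] R[i]^o.

Section Discs.
Context {R : realType}.
Local Notation C := R[i].

Definition disc : set C := [set z | `|z| < 1].
Definition cdisc : set C := [set z | `|z| <= 1].

(* Derivability in the direction [1] over the field [R[i]] is existence of the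
   complex derivative. *)
Definition holomorphic_on (D : set C) (f : C -> C) : Prop :=
  forall z, D z -> derivable f z 1.

Definition disc_sup_norm (f : C -> C) : R :=
  sup [set complex.Re `|f z| | z in disc].

(* A function on a subset [K] of the plane is represented by its extension by
   [0], so that equality of functions on [K] is Leibniz equality. *)
Definition null_off (K : set C) (f : C -> C) : Prop :=
  forall z, ~ K z -> f z = 0.

Definition Hinfty_set : set (C -> C) := [set f |
  [/\ null_off disc f, holomorphic_on disc f & [bounded f z | z in disc]]].

Definition disc_algebra_set : set (C -> C) := [set f |
  [/\ null_off cdisc f, holomorphic_on disc f & {within cdisc, continuous f}]].

Definition is_finite_blaschke (B : C -> C) : Prop :=
  exists (n : nat) (a : 'I_n -> C) (c : C),
    [/\ forall k, disc (a k), `|c| = 1 &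
        B = fun z => c * \prod_(k < n) ((a k - z) / (1 - (a k)^* * z))].

(* Taking [K] to be [cdisc] or [disc] gives the same family of functions, seen
   in the disc algebra and, by restriction to the open disc, in [H^oo]. *)
Definition FBP (K : set C) : set (C -> C) :=
  [set patch (fun=> 0) K B | B in is_finite_blaschke].

End Discs.

Definition closed_unit_ball (K : numDomainType) (V : normedModType K) : set V :=
  [set x | `|x| <= 1].

Definition closed_in (T : topologicalType) (B S : set T) : Prop :=
  closed (S : set (subspace B)).

Section SupNorm.
Context {R : realType}.
Local Notation C := R[i].
Implicit Types (f g : C -> C) (z : C).

Lemma disc0 : disc (0 : C).
Proof. by rewrite /disc /= normr0 ltr01. Qed.

Lemma disc_cdisc : @disc R `<=` cdisc.
Proof. by move=> z /ltW. Qed.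

Lemma ReK (e : C) : 0 <= e -> (complex.Re e)%:C = e.
Proof. by move=> e0; apply: RRe_real; exact: ger0_real. Qed.

Lemma ReMK (e : C) (s : R) : 0 <= e -> (complex.Re e * s)%:C = e * s%:C.
Proof. by move=> e0; rewrite -{2}(ReK e0) rmorphM. Qed.

Lemma lec_Re (x y : C) : x <= y -> complex.Re x <= complex.Re y.
Proof. by rewrite lecE => /andP[]. Qed.

Lemma bounded_has_sup f : [bounded f z | z in disc] ->
  has_sup [set complex.Re `|f z| | z in disc].
Proof.
move=> [M [Mr fM]]; split; first by exists (complex.Re `|f 0|), 0 => //; exact: disc0.
exists (complex.Re (M + 1)) => _ [z Dz <-].
by apply: lec_Re; apply: (fM (M + 1)) => //; rewrite ltrDl ltr01.
Qed.

Lemma disc_sup_norm_ge f z : [bounded f w | w in disc] -> disc z ->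
  `|f z| <= (disc_sup_norm f)%:C.
Proof.
move=> bf Dz; rewrite -(ReK (normr_ge0 (f z))) lecR.
by apply: sup_upper_bound; [exact: bounded_has_sup|exists z].
Qed.

Lemma disc_sup_norm_le f (M : R) : (forall z, disc z -> `|f z| <= M%:C) ->
  disc_sup_norm f <= M.
Proof.
move=> fM; apply: ge_sup; first by exists (complex.Re `|f 0|), 0 => //; exact: disc0.
by move=> _ [z Dz <-]; have /lec_Re := fM _ Dz.
Qed.

Lemma disc_sup_norm_ge0 f : [bounded f z | z in disc] -> 0 <= disc_sup_norm f.
Proof.
move=> bf; rewrite -lecR; apply: le_trans (disc_sup_norm_ge bf disc0).
exact: normr_ge0.
Qed.

Lemma disc_sup_normD f g :
  [bounded f z | z in disc] -> [bounded g z | z in disc] ->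
  disc_sup_norm (f + g) <= disc_sup_norm f + disc_sup_norm g.
Proof.
move=> bf bg; apply: disc_sup_norm_le => z Dz.
rewrite rmorphD /=; apply: le_trans (ler_normD _ _) _.
by apply: lerD; exact: disc_sup_norm_ge.
Qed.

Lemma disc_sup_norm0 : disc_sup_norm (0 : C -> C) = 0.
Proof.
apply/eqP; rewrite eq_le; apply/andP; split.
  by apply: disc_sup_norm_le => z _; rewrite normr0.
apply: disc_sup_norm_ge0; exists 0; split=> // M M0 z _.
by rewrite /= normr0 ltW.
Qed.

Lemma bounded_discZ (a : C) f : [bounded f z | z in disc] ->
  [bounded (a *: f) z | z in disc].
Proof.
move=> bf; exists (`|a| * (disc_sup_norm f)%:C); split.
  by rewrite realM ?normr_real// ger0_real// ler0c disc_sup_norm_ge0.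
move=> M ltM z Dz; apply: le_trans (ltW ltM).
by rewrite /= normrZ ler_wpM2l// disc_sup_norm_ge.
Qed.

Lemma bounded_discD f g :
  [bounded f z | z in disc] -> [bounded g z | z in disc] ->
  [bounded (f + g) z | z in disc].
Proof.
move=> bf bg; exists ((disc_sup_norm f)%:C + (disc_sup_norm g)%:C); split.
  by rewrite realD// ger0_real// ler0c disc_sup_norm_ge0.
move=> M ltM z Dz; apply: le_trans (ltW ltM).
by apply: le_trans (ler_normD _ _) _; rewrite lerD// disc_sup_norm_ge.
Qed.

Lemma disc_sup_normZ_le (a : C) f : [bounded f z | z in disc] ->
  disc_sup_norm (a *: f) <= complex.Re `|a| * disc_sup_norm f.
Proof.
move=> bf; apply: disc_sup_norm_le => z Dz.
by rewrite ReMK// -[(a *: f) z]/(a * f z) normrM ler_wpM2l// disc_sup_norm_ge.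
Qed.

Lemma disc_sup_normZ (a : C) f : [bounded f z | z in disc] ->
  (disc_sup_norm (a *: f))%:C = `|a| * (disc_sup_norm f)%:C.
Proof.
move=> bf; have [->|a0] := eqVneq a 0.
  by rewrite normr0 mul0r scale0r disc_sup_norm0.
apply/eqP; rewrite eq_le; apply/andP; split.
  by rewrite -ReMK// lecR disc_sup_normZ_le.
have := disc_sup_normZ_le a^-1 (bounded_discZ a bf).
rewrite scalerA mulVf// scale1r -lecR ReMK// normfV.
by rewrite ler_pdivlMl ?normr_gt0.
Qed.

Lemma disc_sup_norm0_eq0 f z : [bounded f w | w in disc] ->
  (disc_sup_norm f)%:C = 0 -> disc z -> f z = 0.
Proof.
move=> bf f0 Dz; apply/eqP; rewrite -normr_le0 -f0.
exact: disc_sup_norm_ge.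
Qed.

Lemma holomorphic_onZD (a : C) f g D : holomorphic_on D f ->
  holomorphic_on D g -> holomorphic_on D (a *: f + g).
Proof.
move=> hf hg z Dz; apply: derivableD (hg z Dz).
exact: derivableZ (hf z Dz).
Qed.

Lemma within_continuousZD (K : set C) (a : C) f g :
  {within K, continuous f} -> {within K, continuous g} ->
  {within K, continuous (a *: f + g)}.
Proof.
move=> /subspace_continuousP cf /subspace_continuousP cg.
apply/subspace_continuousP => z Kz.
apply: (@cvgD C C _ _ _ (a *: f) g (a * f z) (g z) _ (cg z Kz)).
exact: (@cvgM _ _ _ _ (cst a) f a (f z) (cvg_cst a) (cf z Kz)).
Qed.

Lemma null_offZD (K : set C) (a : C) f g :
  null_off K f -> null_off K g -> null_off K (a *: f + g).
Proof.
move=> hf hg z Kz; rewrite -[LHS]/(a *: f z + g z).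
by rewrite hf// hg// scaler0 addr0.
Qed.

End SupNorm.

Section CompactDisc.
Context {R : realType}.
Local Notation C := R[i].

Lemma continuous_real_complex : continuous (fun x : R => x%:C : C).
Proof.
move=> x; apply/cvgrPdist_lt => e e0.
near=> y; rewrite -rmorphB normc_def /= expr0n addr0 sqrtr_sqr.
rewrite -(ReK (ltW e0)) ltcR; near: y.
by apply: cvgr_dist_lt => //; rewrite -ltcR ReK// ltW.
Unshelve. all: by end_near. Qed.

Lemma continuous_Re : continuous (@complex.Re R : C -> R).
Proof.
move=> z; apply: (iffRL (@cvgrPdist_lt _ _ _ (nbhs z) _ _ _)) => e e0.
have e0' : 0 < e%:C :> C by rewrite ltcR.
apply/nbhs_ballP; exists e%:C => //= w.
rewrite -ball_normE /ball_ /= => zw; rewrite -ltcR; apply: le_lt_trans zw.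
have -> : complex.Re z - complex.Re w = complex.Re (z - w).
  by case: z w => [a b] [c d].
exact: normc_ge_Re.
Qed.

Lemma continuous_Re_norm : continuous (fun z : C => complex.Re `|z|).
Proof.
move=> z; apply: (@continuous_comp C C R (fun w : C => `|w| : C) (@complex.Re R)).
  exact: norm_continuous.
exact: continuous_Re.
Qed.

Lemma closed_cdisc : closed (@cdisc R).
Proof.
move=> z clz; rewrite /cdisc /= real_leNgt ?normr_real ?real1//.
apply/negP => z1; have e0 : 0 < `|z| - 1 by rewrite subr_gt0.
have [w []] := clz _ (nbhsx_ballx z _ e0).
rewrite /cdisc /= -ball_normE /ball_ /= => w1 zw.
have := ler_normD (z - w) w; rewrite subrK => /le_lt_trans.
move=> /(_ (`|z| - 1 + 1)); rewrite subrK ltxx => h.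
by apply: notF; apply: h; rewrite -[ltRHS](subrK 1) ltr_leD.
Qed.

Lemma compact_cdisc : compact (@cdisc R).
Proof.
pose g (p : R * R) : C := p.1%:C + 'i%C * p.2%:C.
have cg : continuous g.
  move=> p; apply: cvgD.
    by apply: continuous_comp; [exact: cvg_fst|exact: continuous_real_complex].
  apply: cvgM; first exact: cvg_cst.
  by apply: continuous_comp; [exact: cvg_snd|exact: continuous_real_complex].
pose S : set (R * R) := `[-1, 1]%classic `*` `[-1, 1]%classic.
have cS : compact (g @` S).
  apply: continuous_compact; first exact: continuous_subspaceT.
  by apply: compact_setX; exact: segment_compact.
apply: subclosed_compact cS _.
  exact: closed_cdisc.
move=> z; rewrite /cdisc /= => z1; exists (complex.Re z, complex.Im z).
  have sq : complex.Re z ^+ 2 + complex.Im z ^+ 2 <= 1.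
    by rewrite -lecR add_Re2_Im2 rmorph1 exprn_ile1.
  have le1 x y : x ^+ 2 + y ^+ 2 <= 1 -> -1 <= x <= (1 : R).
    move=> xy; rewrite -ler_norml -[_ <= _](@ler_pXn2r _ 2)// ?nnegrE//.
    rewrite expr1n real_normK ?num_real//; apply: le_trans xy.
    by rewrite lerDl sqr_ge0.
  by split; rewrite /= in_itv /=; [apply: le1 sq|apply: le1; rewrite addrC; exact: sq].
by rewrite /g /= -complexE.
Qed.

Lemma within_cdisc_bounded (f : C -> C) : {within cdisc, continuous f} ->
  [bounded f z | z in disc].
Proof.
move=> cf; pose g z : R := complex.Re `|f z|.
have cg : {within cdisc, continuous g}.
  move=> z; apply: (@cvg_comp _ _ _ f (fun w => complex.Re `|w|) _ _ _ (cf z)).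
  exact: continuous_Re_norm.
have := continuous_compact cg compact_cdisc.
move=> /compact_bounded [M [Mr gM]]; exists (M + 1)%:C; split.
  by apply/complex_realP; exists (M + 1).
move=> N MN z Dz; apply: le_trans (ltW MN).
rewrite -(ReK (normr_ge0 (f z))) lecR; apply: le_trans (ler_norm _) _.
by apply: (gM (M + 1) _ (g z)); [rewrite ltrDl|exists z => //; exact: disc_cdisc].
Qed.

Lemma within_cdisc_eq0 (f : C -> C) : {within cdisc, continuous f} ->
  (forall z, disc z -> f z = 0) -> forall z, cdisc z -> f z = 0.
Proof.
move=> cf f0 z Kz; apply/eqP; apply/negPn/negP => fz.
have fz0 : 0 < `|f z| by rewrite normr_gt0.
have /subspace_continuousP/(_ z Kz)/cvgrPdist_lt/(_ _ fz0) := cf.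
move=> /nbhs_ballP[e /= e0 he].
pose t : C := (Num.min (complex.Re e / 2) 1)%:C.
have re0 : 0 < complex.Re e by rewrite -ltcR ReK// ltW.
have t0 : 0 < t by rewrite ltcR lt_min ltr01 divr_gt0.
have t1 : t <= 1 by rewrite lecR ge_min lexx orbT.
have te : t < e.
  rewrite -(ReK (ltW e0)) ltcR gt_min; apply/orP; left.
  by rewrite gtr_pMr// invf_lt1// ltr1n.
have Dw : disc ((1 - t) * z).
  rewrite /disc /= normrM ger0_norm ?subr_ge0//.
  apply: (@le_lt_trans _ _ ((1 - t) * 1)); last by rewrite mulr1 gtrBl.
  by rewrite ler_wpM2l ?subr_ge0.
have /he : ball z e ((1 - t) * z).
  rewrite -ball_normE /ball_ /= mulrBl mul1r opprB addrC subrK normrM gtr0_norm//.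
  by apply: le_lt_trans te; rewrite ler_piMr// ltW.
move=> /(_ (disc_cdisc Dw)); rewrite -[ltLHS]/(`|f z - f ((1 - t) * z)|).
by rewrite (f0 _ Dw) subr0 ltxx.
Qed.

End CompactDisc.

Section Spaces.
Variable R : realType.
Local Notation C := R[i].

Definition Hinfty_pred : {pred C -> C} := mem (@Hinfty_set R).
Definition disc_algebra_pred : {pred C -> C} := mem (@disc_algebra_set R).

Lemma Hinfty_submod : submod_closed Hinfty_pred.
Proof.
split.
  rewrite inE; split=> //.
  exists 0; split; first exact: real0.
  by move=> M M0 z _; rewrite /= normr0 ltW.
move=> a f g /set_mem[f1 f2 f3] /set_mem[g1 g2 g3]; apply: mem_set; split.
- exact: null_offZD.
- exact: holomorphic_onZD.
- exact: bounded_discD (bounded_discZ a f3) g3.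
Qed.

Lemma disc_algebra_submod : submod_closed disc_algebra_pred.
Proof.
split.
  rewrite inE; split=> //.
  by move=> z; exact: cvg_cst.
move=> a f g /set_mem[f1 f2 f3] /set_mem[g1 g2 g3]; apply: mem_set; split.
- exact: null_offZD.
- exact: holomorphic_onZD.
- exact: within_continuousZD.
Qed.

HB.instance Definition _ :=
  GRing.isSubmodClosed.Build C (C -> C) Hinfty_pred Hinfty_submod.
HB.instance Definition _ :=
  GRing.isSubmodClosed.Build C (C -> C) disc_algebra_pred disc_algebra_submod.

Record Hinfty := MkHinfty {
  Hinfty_fun :> C -> C;
  _ : Hinfty_fun \in Hinfty_pred }.

HB.instance Definition _ := [isSub for Hinfty_fun].
HB.instance Definition _ := [Choice of Hinfty by <:].
HB.instance Definition _ := [SubChoice_isSubLmodule of Hinfty by <:].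

Record disc_algebra := MkDiscAlgebra {
  disc_algebra_fun :> C -> C;
  _ : disc_algebra_fun \in disc_algebra_pred }.

HB.instance Definition _ := [isSub for disc_algebra_fun].
HB.instance Definition _ := [Choice of disc_algebra by <:].
HB.instance Definition _ := [SubChoice_isSubLmodule of disc_algebra by <:].

Lemma HinftyP (f : Hinfty) : Hinfty_set f.
Proof. by case: f => f /=; rewrite inE. Qed.

Lemma disc_algebraP (f : disc_algebra) : disc_algebra_set f.
Proof. by case: f => f /=; rewrite inE. Qed.

Lemma Hinfty_bounded (f : Hinfty) : [bounded f z | z in disc].
Proof. by have [] := HinftyP f. Qed.

Lemma disc_algebra_bounded (f : disc_algebra) : [bounded f z | z in disc].
Proof. by have [_ _ /within_cdisc_bounded] := disc_algebraP f. Qed.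

Definition Hinfty_norm (f : Hinfty) : C := (disc_sup_norm f)%:C.

Definition disc_algebra_norm (f : disc_algebra) : C := (disc_sup_norm f)%:C.

Lemma Hinfty_normD f g : Hinfty_norm (f + g) <= Hinfty_norm f + Hinfty_norm g.
Proof.
rewrite /Hinfty_norm -rmorphD lecR; apply: disc_sup_normD; exact: Hinfty_bounded.
Qed.

Lemma Hinfty_normZ (a : C) f : Hinfty_norm (a *: f) = `|a| * Hinfty_norm f.
Proof. exact: disc_sup_normZ (Hinfty_bounded f). Qed.

Lemma Hinfty_norm_eq0 f : Hinfty_norm f = 0 -> f = 0.
Proof.
move=> f0; apply/val_inj/funext => z /=.
have [Dz|Dz] := pselect (disc z).
  exact: disc_sup_norm0_eq0 (Hinfty_bounded f) f0 Dz.
by have [-> //] := HinftyP f.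
Qed.

Lemma disc_algebra_normD f g :
  disc_algebra_norm (f + g) <= disc_algebra_norm f + disc_algebra_norm g.
Proof.
rewrite /disc_algebra_norm -rmorphD lecR; apply: disc_sup_normD;
  exact: disc_algebra_bounded.
Qed.

Lemma disc_algebra_normZ (a : C) f :
  disc_algebra_norm (a *: f) = `|a| * disc_algebra_norm f.
Proof. exact: disc_sup_normZ (disc_algebra_bounded f). Qed.

Lemma disc_algebra_norm_eq0 f : disc_algebra_norm f = 0 -> f = 0.
Proof.
move=> f0; apply/val_inj/funext => z /=.
have [nf _ cf] := disc_algebraP f.
have [Dz|Dz] := pselect (cdisc z); last exact: nf.
apply: within_cdisc_eq0 cf _ z Dz => z.
exact: disc_sup_norm0_eq0 (disc_algebra_bounded f) f0.
Qed.

HB.instance Definition _ := Lmodule_isNormed.Build C Hinfty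
  Hinfty_normD Hinfty_normZ Hinfty_norm_eq0.
HB.instance Definition _ := Lmodule_isNormed.Build C disc_algebra
  disc_algebra_normD disc_algebra_normZ disc_algebra_norm_eq0.

Definition BHinfty : set Hinfty := @closed_unit_ball C Hinfty.
Definition Bdisc_algebra : set disc_algebra := @closed_unit_ball C disc_algebra.

End Spaces.

Arguments BHinfty : clear implicits.
Arguments Bdisc_algebra : clear implicits.

(* Main.v *)
(* The degrees of the finite Blaschke products close to a given one are bounded
   by its degree, by a form of Rouche's theorem. A Blaschke factor
   (a - z) / (1 - a^* z) with |a| = 1 is the constant a on the open disc, so the
   products of at most n such factors with |a| <= 1 form a compact set for
   pointwise convergence on the disc, all of whose members are finite Blaschke
   products there. A uniform limit of finite Blaschke products is therefore a
   finite Blaschke product on the disc, hence on its closure by continuity. *)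
Require Import Defs.
From mathcomp Require Import all_boot all_order all_algebra.
From mathcomp Require Import all_classical all_reals all_analysis.
From mathcomp Require Import complex.
From mathcomp Require Import ring.

Set Implicit Arguments.
Unset Strict Implicit.
Unset Printing Implicit Defensive.

Import Order.TTheory GRing.Theory Num.Theory.
Import numFieldNormedType.Exports.

Local Open Scope classical_set_scope.
Local Open Scope complex_scope.
Local Open Scope ring_scope.

Section Blaschke.
Context {R : realType}.
Local Notation C := R[i].
Implicit Types (a c d z w : C) (s t : seq C).

(** * Blaschke factors and products on the disc and on the circle *)

Lemma Re_realM (x : R) z : complex.Re (x%:C * z) = x * complex.Re z.
Proof. by case: z => u v; rewrite /= mul0r subr0. Qed.

Lemma conjC_continuous : continuous (@Num.conj C).
Proof.
move=> z; apply: (iffRL (@cvgrPdist_lt _ _ _ (nbhs z) _ _ _)) => e e0.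
apply/nbhs_ballP; exists e => //= w.
by rewrite -ball_normE /ball_ /= -rmorphB norm_conjC.
Qed.

(** The parameter [a] ranges over the whole plane because parameters on the unit circle arise as
    limits. *)
Definition blaschke_factor a z : C := (a - z) / (1 - a^* * z).

(** The zeros form a list, which suits induction and makes the degree [size s]. *)
Definition blaschke c s z : C := c * \prod_(a <- s) blaschke_factor a z.

Lemma blaschke_den_neq0 a z : `|a| * `|z| < 1 -> 1 - a^* * z != 0.
Proof.
move=> az; rewrite subr_eq0; apply: contraTneq az => az.
by rewrite -(norm_conjC a) -normrM -az normr1 ltxx.
Qed.

(** After clearing the denominator and squaring, the bound says that [(1 - |a|^2) (1 - |z|^2)] is
    nonnegative. *)
Lemma blaschke_factor_le1 a z : `|a| < 1 -> `|z| <= 1 ->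
  `|blaschke_factor a z| <= 1.
Proof.
move=> a1 z1; have D0 : 1 - a^* * z != 0.
  by apply: blaschke_den_neq0; apply: le_lt_trans a1; rewrite ler_piMr.
rewrite normrM normfV ler_pdivrMr ?normr_gt0// mul1r.
rewrite -(@ler_pXn2r _ 2)// ?nnegrE//.
rewrite -subr_ge0.
suff -> : `|1 - a^* * z| ^+ 2 - `|a - z| ^+ 2 = (1 - `|a| ^+ 2) * (1 - `|z| ^+ 2).
  by rewrite mulr_ge0// subr_ge0 exprn_ile1// ltW.
by rewrite !normCK !rmorphB rmorphM rmorph1 /= conjCK; ring.
Qed.

(** Since [z z^* = 1], the numerator is [- z] times the conjugate of the denominator. *)
Lemma blaschke_factor_circle a z : `|z| = 1 ->
  blaschke_factor a z = - z * ((1 - a^* * z)^* / (1 - a^* * z)).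
Proof.
move=> z1; rewrite /blaschke_factor mulrA; congr (_ / _).
rewrite rmorphB rmorphM rmorph1 /= conjCK mulrBr mulr1 mulNr opprK.
by rewrite mulrCA -normCK z1 expr1n mulr1 addrC.
Qed.

Lemma blaschke_factor_unimodular a z : `|a| = 1 -> `|z| < 1 ->
  blaschke_factor a z = a.
Proof.
move=> a1 z1; rewrite /blaschke_factor.
have -> : a - z = a * (1 - a^* * z).
  by rewrite mulrBr mulr1 mulrA -normCK a1 expr1n mul1r.
by rewrite mulfK// blaschke_den_neq0// a1 mul1r.
Qed.

Lemma blaschke_le1 c s z : `|c| = 1 -> (forall a, a \in s -> `|a| < 1) ->
  `|z| <= 1 -> `|blaschke c s z| <= 1.
Proof.
move=> c1 s1 z1; rewrite /blaschke normrM c1 mul1r big_seq.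
apply: (big_ind (fun x : C => `|x| <= 1)); first by rewrite normr1.
  by move=> x y x1 y1; rewrite normrM mulr_ile1.
by move=> a /s1 a1; exact: blaschke_factor_le1.
Qed.

Lemma is_finite_blaschkeP (B : C -> C) : is_finite_blaschke B <->
  exists c s, [/\ `|c| = 1, forall a, a \in s -> `|a| < 1 & B = blaschke c s].
Proof.
split=> [[n [a [c [a1 c1 ->]]]]|[c [s [c1 s1 ->]]]].
  exists c, [seq a k | k <- enum 'I_n]; split=> //.
    by move=> _ /mapP[k _ ->]; exact: a1.
  by apply/funext => z; rewrite /blaschke big_map big_enum.
exists (size s), (fun k => nth 0 s k), c; split=> //.
  by move=> k; apply: s1; rewrite mem_nth.
by apply/funext => z; rewrite /blaschke (big_nth 0) big_mkord.
Qed.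

(** Parameters on the circle contribute unimodular constants, absorbed into [c]; the others are kept
    as zeros. Equality is claimed on the open disc only, since the denominator for [|a| = 1]
    vanishes at [z = a]. *)
Lemma prod_blaschke_factor t : (forall a, a \in t -> `|a| <= 1) ->
  exists c s, [/\ `|c| = 1, forall a, a \in s -> `|a| < 1 &
    forall z, `|z| < 1 -> \prod_(a <- t) blaschke_factor a z = blaschke c s z].
Proof.
elim: t => [_|a t IH at1].
  exists 1, [::]; split=> [|//|z _]; first exact: normr1.
  by rewrite /blaschke !big_nil mulr1.
have [b bt|c [s [c1 s1 E]]] := IH; first by apply: at1; rewrite inE bt orbT.
have := at1 _ (mem_head a t); rewrite le_eqVlt => /orP[/eqP a1|a1].
  exists (a * c), s; split=> [|//|z z1]; first by rewrite normrM a1 c1 mulr1.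
  by rewrite big_cons E// blaschke_factor_unimodular// /blaschke mulrA.
exists c, (a :: s); split=> // [b|z z1].
  by rewrite inE => /predU1P[->//|/s1].
by rewrite big_cons E// /blaschke big_cons mulrCA.
Qed.

(** * Limits of complex functions, and positive real parts of rational functions *)

Lemma cvg_complexM T (F : set_system T) {FF : Filter F} (f g : T -> C) z w :
  f x @[x --> F] --> z -> g x @[x --> F] --> w ->
  f x * g x @[x --> F] --> z * w.
Proof. exact: (@cvgM C T F FF f g z w). Qed.

Lemma cvg_complexB T (F : set_system T) {FF : Filter F} (f g : T -> C) z w :
  f x @[x --> F] --> z -> g x @[x --> F] --> w ->
  f x - g x @[x --> F] --> z - w.
Proof. by move=> fz gw; exact: cvgB fz gw. Qed.

Lemma cvg_complex_div T (F : set_system T) {FF : Filter F} (f g : T -> C) z w :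
  w != 0 -> f x @[x --> F] --> z -> g x @[x --> F] --> w ->
  f x / g x @[x --> F] --> z / w.
Proof.
move=> w0 fz gw; apply: cvg_complexM fz _.
exact: (@cvgV C T F FF g w w0 gw).
Qed.

Lemma cvg_horner (P : {poly C}) T (F : set_system T) {FF : Filter F}
    (f : T -> C) z : f x @[x --> F] --> z -> P.[f x] @[x --> F] --> P.[z].
Proof.
move=> fz; elim/poly_ind: P => [|P c IH].
  rewrite horner0 [X in X @ _ --> _](_ : _ = cst 0); first exact: cvg_cst.
  by apply/funext => w; rewrite horner0.
rewrite [X in X @ _ --> _](_ : _ = fun x => P.[f x] * f x + c); last first.
  by apply/funext => w; rewrite !hornerE.
rewrite hornerD hornerMX hornerC; apply: cvgD; last exact: cvg_cst.
exact: cvg_complexM.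
Qed.

Lemma cvg_complex_Re T (F : set_system T) {FF : Filter F} (f : T -> C) z :
  f x @[x --> F] --> z -> complex.Re (f x) @[x --> F] --> complex.Re z.
Proof.
by move=> fz; apply: continuous_cvg fz; exact: continuous_Re.
Qed.

Lemma cvg_complex_norm T (F : set_system T) {FF : Filter F} (f : T -> C) z :
  f x @[x --> F] --> z ->
  complex.Re `|f x| @[x --> F] --> complex.Re `|z|.
Proof.
by move=> fz; apply: continuous_cvg fz; exact: continuous_Re_norm.
Qed.

(* D'Alembert's argument: near an interior minimum [c] of the real part, the
   quotient minus its value at [c] is [(z - c)^m u(z)] with [u c != 0], and
   [(z - c)^m] can be given any direction. *)
Lemma horner_quotient_Re_gt0 (N D : {poly C}) :
  (forall z, `|z| <= 1 -> D.[z] != 0) ->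
  (forall z, `|z| = 1 -> 0 < complex.Re (N.[z] / D.[z])) ->
  0 < complex.Re (N.[0] / D.[0]).
Proof.
move=> D0 Npos.
pose g z := complex.Re (N.[z] / D.[z]).
have quoC (P : {poly C}) T (F : set_system T) (FF : Filter F) (f : T -> C) z :
    `|z| <= 1 -> f x @[x --> F] --> z ->
    P.[f x] / D.[f x] @[x --> F] --> P.[z] / D.[z].
  by move=> z1 fz; apply: cvg_complex_div; [exact: D0|exact: cvg_horner..].
have cg : {within cdisc, continuous g}.
  apply/subspace_continuousP => z z1; apply: cvg_complex_Re.
  by apply: quoC => //; exact: cvg_within.
(* A minimiser on the closed disc. On the circle it gives the claim at once; in the interior, either
   the quotient is constant or a smaller value is found nearby. *)
have [|c /set_mem c1 gc] := compact_EVT_min _ compact_cdisc cg.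
  by exists 0; rewrite /cdisc /= normr0.
have zero1 : (0 : C) \in cdisc by rewrite inE /cdisc /= normr0.
have [c1'|c1'] := eqVneq `|c| 1.
  by apply: lt_le_trans (gc _ zero1); exact: Npos.
have {}c1' : `|c| < 1 by rewrite lt_neqAle c1'.
pose w := N.[c] / D.[c].
pose P := N - w *: D.
have PE z : N.[z] = P.[z] + w * D.[z] by rewrite !hornerE subrK.
have [P0|P0] := eqVneq P 0.
  have E z : `|z| <= 1 -> N.[z] / D.[z] = w.
    by move=> z1; rewrite PE P0 horner0 add0r mulfK ?D0.
  rewrite E ?normr0// -(E 1) ?normr1//; apply: Npos; exact: normr1.
have [m [k]] := multiplicity_XsubC P c.
rewrite P0 /= => kc PEk.
have Pc : P.[c] = 0 by rewrite !hornerE /w divfK ?D0// subrr.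
have m0 : (0 < m)%N.
  case: m PEk => // PEk; move: kc; rewrite /root.
  by rewrite -Pc PEk expr0 mulr1 eqxx.
pose v := k.[c] / D.[c].
have v0 : v != 0 by rewrite mulf_neq0 ?invr_eq0 ?D0.
(* With [o ^+ m * v = -1], a small step [x * o] away from [c] changes the quotient by about
   [- x ^+ m]. *)
pose o := m.-root (- v^-1).
have om : o ^+ m = - v^-1 by rewrite rootCK.
pose y (x : R) := c + x%:C * o.
have yc : y x @[x --> 0^'+] --> c.
  rewrite -[X in _ --> X]addr0 -(mul0r o); apply: cvgD; first exact: cvg_cst.
  apply: cvg_complexM; last exact: cvg_cst.
  by apply: cvg_at_right_filter; exact: continuous_real_complex.
have [x [x0 yx1 yxneg]] : exists x : R, [/\ 0 < x, `|y x| < 1 &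
    complex.Re (o ^+ m * (k.[y x] / D.[y x])) < 0].
  have near_norm : complex.Re `|y x| @[x --> 0^'+] --> complex.Re `|c|.
    exact: cvg_complex_norm yc.
  have lim : complex.Re (o ^+ m * (k.[y x] / D.[y x])) @[x --> 0^'+] --> (-1 : R).
    have -> : -1 = complex.Re (o ^+ m * v) by rewrite om mulNr mulVf.
    apply: cvg_complex_Re; apply: cvg_complexM; first exact: cvg_cst.
    exact: quoC.
  have lt1 : complex.Re `|c| < 1 by rewrite -ltcR ReK.
  have nearN := cvgr_lt _ near_norm _ lt1.
  have nearR := cvgr_lt _ lim _ (ltrN10 _).
  near (0 : R)^'+ => x; exists x; split; first by [].
    by rewrite -[`|_|]ReK// -[1]/(1%:C) ltcR; near: x; exact: nearN.
  by near: x; exact: nearR.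
have := gc (y x); rewrite inE => /(_ (ltW yx1)).
suff -> : g (y x) = g c + x ^+ m * complex.Re (o ^+ m * (k.[y x] / D.[y x])).
  by rewrite lerDl pmulr_rge0 ?exprn_gt0// leNgt yxneg.
rewrite /g PE PEk !hornerE -/w mulrDl mulfK ?D0 ?ltW//.
rewrite /y addrAC subrr add0r exprMn.
rewrite addrC raddfD /= -Re_realM rmorphXn; congr (_ + complex.Re _).
by ring.
Unshelve. all: by end_near. Qed.

(** * Comparison of degrees on the unit circle *)

(** A polynomial, so that [horner_quotient_Re_gt0] applies to quotients built from it. *)
Definition blaschke_den s : {poly C} := \prod_(a <- s) (1 - (a^*)%:P * 'X).

Lemma horner_blaschke_den s z :
  (blaschke_den s).[z] = \prod_(a <- s) (1 - a^* * z).
Proof.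
by rewrite horner_prod; apply: eq_bigr => a _; rewrite !hornerE.
Qed.

Lemma horner_blaschke_den_neq0 s z : (forall a, a \in s -> `|a| < 1) ->
  `|z| <= 1 -> (blaschke_den s).[z] != 0.
Proof.
move=> s1 z1; rewrite horner_blaschke_den prodf_seq_neq0.
apply/allP => a /s1 a1; apply: blaschke_den_neq0.
by apply: le_lt_trans a1; rewrite ler_piMr.
Qed.

(** The formula for one factor, multiplied over the zeros: besides the degree, they enter only
    through a quotient of modulus 1. *)
Lemma blaschke_circle c s z : `|z| = 1 ->
  blaschke c s z = c * (- z) ^+ size s *
    ((blaschke_den s).[z]^* / (blaschke_den s).[z]).
Proof.
move=> z1; rewrite /blaschke -mulrA; congr (_ * _).
rewrite horner_blaschke_den rmorph_prod -prodf_div.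
have -> : (- z) ^+ size s = \prod_(a <- s) (- z).
  by rewrite big_const_seq count_predT iter_mulr_1.
by rewrite -big_split /=; apply: eq_bigr => a _; exact: blaschke_factor_circle.
Qed.

Lemma blaschke_circle_norm c s z : `|c| = 1 ->
  (forall a, a \in s -> `|a| < 1) -> `|z| = 1 -> `|blaschke c s z| = 1.
Proof.
move=> c1 s1 z1; rewrite blaschke_circle// !normrM normrX normrN c1 z1.
rewrite expr1n !mul1r normfV norm_conjC divff// normr_eq0.
by rewrite horner_blaschke_den_neq0 ?z1.
Qed.

(* A form of Rouche's theorem. On the circle the quotient of the two products
   is, up to a positive factor, [G z = (d / c) (- z)^m (q_s z / q_t z)^2] with
   [m = size t - size s]; it would have positive real part there, although
   [G 0 = 0] if [m > 0]. *)
Lemma blaschke_degree_le c d s t : `|c| = 1 -> `|d| = 1 ->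
  (forall a, a \in s -> `|a| < 1) -> (forall a, a \in t -> `|a| < 1) ->
  (forall z, `|z| = 1 -> `|blaschke c s z - blaschke d t z| < 1) ->
  (size t <= size s)%N.
Proof.
move=> c1 d1 s1 t1 near_st; rewrite leqNgt; apply/negP => lt_st.
have c0 : c != 0 by rewrite -normr_eq0 c1 oner_neq0.
pose m := (size t - size s)%N.
have m0 : (0 < m)%N by rewrite subn_gt0.
pose N : {poly C} := (d / c)%:P * ((- 'X) ^+ m * blaschke_den s ^+ 2).
have NE z : N.[z] = d / c * ((- z) ^+ m * (blaschke_den s).[z] ^+ 2).
  by rewrite hornerM hornerC hornerM !horner_exp hornerN hornerX.
suff : 0 < complex.Re (N.[0] / (blaschke_den t ^+ 2).[0]).
  by rewrite NE oppr0 expr0n gtn_eqF// mul0r mulr0 mul0r ltxx.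
apply: (@horner_quotient_Re_gt0 N (blaschke_den t ^+ 2)) => z z1.
  by rewrite hornerE expf_neq0// horner_blaschke_den_neq0.
set u := (blaschke_den s).[z]; set v := (blaschke_den t).[z].
have u0 : u != 0 by rewrite horner_blaschke_den_neq0 ?z1.
have v0 : v != 0 by rewrite horner_blaschke_den_neq0 ?z1.
have B1 := blaschke_circle_norm c1 s1 z1.
have B0 : blaschke c s z != 0 by rewrite -normr_eq0 B1 oner_neq0.
pose q := blaschke d t z / blaschke c s z.
(* As [blaschke c s z] has modulus 1, dividing by it puts [q] in the open disc of radius 1 about
   1. *)
have q_gt0 : 0 < complex.Re q.
  have : `|1 - q| < 1.
    by rewrite -{1}(divff B0) -mulrBl normrM normfV B1 invr1 mulr1 near_st.
  move=> /(le_lt_trans (normc_ge_Re _)); rewrite ltcR => /ltr_normlW.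
  by rewrite raddfB /= gtrBl.
have r_gt0 : 0 < `|u| ^+ 2 / `|v| ^+ 2.
  by rewrite divr_gt0// exprn_gt0// normr_gt0.
suff -> : N.[z] / (blaschke_den t ^+ 2).[z] =
    (complex.Re (`|u| ^+ 2 / `|v| ^+ 2))%:C * q.
  by rewrite Re_realM mulr_gt0// -ltcR ReK// ltW.
rewrite ReK ?ltW// /q !blaschke_circle// NE horner_exp -/u -/v !normCK.
rewrite -(subnK (ltnW lt_st)) -/m exprD.
have uc0 : u^* != 0 by rewrite conjC_eq0.
have vc0 : v^* != 0 by rewrite conjC_eq0.
have zn0 : (- z) ^+ size s != 0.
  by rewrite expf_neq0// oppr_eq0 -normr_eq0 z1 oner_neq0.
by field; rewrite c0 u0 v0 uc0 vc0 zn0.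
Qed.

(** * Continuity and derivability of Blaschke products *)

Lemma cvg_complex_prod (I : Type) (r : seq I) (P : pred I)
    T (F : set_system T) {FF : Filter F} (f : I -> T -> C) (l : I -> C) :
  (forall i, P i -> f i x @[x --> F] --> l i) ->
  \prod_(i <- r | P i) f i x @[x --> F] --> \prod_(i <- r | P i) l i.
Proof.
move=> fl; elim: r => [|i r IH].
  rewrite big_nil [X in X @ _ --> _](_ : _ = cst 1); first exact: cvg_cst.
  by apply/funext => x; rewrite big_nil.
rewrite big_cons [X in X @ _ --> _](_ : _ = fun x =>
  if P i then f i x * \prod_(j <- r | P j) f j x
  else \prod_(j <- r | P j) f j x); last first.
  by apply/funext => x; rewrite big_cons.
case: ifP => [Pi|_]; last exact: IH.
exact: (cvg_complexM (fl i Pi) IH).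
Qed.

(** The condition [|a| |z| < 1] covers both uses: continuity in [z] up to the circle when [|a| < 1],
    and continuity in the parameter up to [|a| = 1] when [|z| < 1]. *)
Lemma cvg_blaschke_factor T (F : set_system T) {FF : Filter F} (f g : T -> C) a z :
  `|a| * `|z| < 1 -> f x @[x --> F] --> a -> g x @[x --> F] --> z ->
  blaschke_factor (f x) (g x) @[x --> F] --> blaschke_factor a z.
Proof.
move=> az fa gz; apply: cvg_complex_div; first exact: blaschke_den_neq0.
  exact: (cvgB fa gz).
have fa' : (f x)^* @[x --> F] --> a^*.
  by apply: continuous_cvg fa; exact: conjC_continuous.
by apply: cvgB; [exact: cvg_cst|exact: (cvg_complexM fa' gz)].
Qed.

Lemma blaschke_continuous c s z : (forall a, a \in s -> `|a| < 1) ->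
  `|z| <= 1 -> {for z, continuous (blaschke c s)}.
Proof.
move=> s1 z1; apply: (cvg_complexM (FF := nbhs_filter z)).
  exact: cst_continuous.
rewrite big_seq [X in X @ _ --> _](_ : _ = fun w =>
  \prod_(a <- s | a \in s) blaschke_factor a w); last first.
  by apply/funext => w; rewrite big_seq.
apply: (cvg_complex_prod (FF := nbhs_filter z)) => a /s1 a1.
apply: (cvg_blaschke_factor (FF := nbhs_filter z) (f := cst a) (g := id)).
- by apply: le_lt_trans a1; rewrite ler_piMr.
- exact: cst_continuous.
- exact: cvg_id.
Qed.

(** The points [(1 - x) z] with small [x > 0] lie in the open disc and tend to [z]. *)
Lemma norm_le_cdisc (f : C -> C) (M : R) z : {for z, continuous f} ->
  (forall w, `|w| < 1 -> `|f w| <= M%:C) -> `|z| <= 1 -> `|f z| <= M%:C.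
Proof.
move=> fz fM z1.
pose y (x : R) : C := z + x%:C * - z.
have yz : y x @[x --> 0^'+] --> z.
  rewrite -[X in _ --> X]addr0 -(mul0r (- z)); apply: cvgD; first exact: cvg_cst.
  apply: cvg_complexM; last exact: cvg_cst.
  by apply: cvg_at_right_filter; exact: continuous_real_complex.
have fyz : complex.Re `|f (y x)| @[x --> 0^'+] --> complex.Re `|f z|.
  by apply: cvg_complex_norm; exact: (cvg_comp y f yz fz).
rewrite -(ReK (normr_ge0 (f z))) lecR.
apply: (cvgr_to_le fyz); near=> x.
rewrite -lecR ReK//; apply: fM.
have -> : y x = (1 - x)%:C * z by rewrite /y rmorphB /=; ring.
rewrite normrM.
have x0 : 0 < x by [].
have x1 : x < 1 by near: x; apply: nbhs_right_lt.
apply: (@le_lt_trans _ _ `|(1 - x)%:C : C|); first by rewrite ler_piMr.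
by rewrite ger0_norm ?ler0c ?subr_ge0 ?ltW// ltcR gtrBl.
Unshelve. all: by end_near. Qed.

Lemma derivable_blaschke c s z : (forall a, a \in s -> `|a| < 1) ->
  `|z| < 1 -> derivable (blaschke c s : C -> C) z 1.
Proof.
move=> s1 z1; elim: s s1 => [|a s IH] s1.
  rewrite (_ : blaschke c [::] = cst c); first exact: derivable_cst.
  by apply/funext => w; rewrite /blaschke big_nil mulr1.
rewrite (_ : blaschke c (a :: s) =
    (fun w => blaschke_factor a w) * blaschke c s); last first.
  by apply/funext => w; rewrite /blaschke big_cons mulrCA.
have a1 : `|a| < 1 by apply: s1; exact: mem_head.
apply: (@derivableM C C); last first.
  by apply: IH => b bs; apply: s1; rewrite inE bs orbT.
apply: (@derivableM C C (fun w => a - w) (fun w => (1 - a^* * w)^-1)).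
  by apply: derivableB; [exact: derivable_cst|exact: derivable_id].
apply: (@derivableV C C (fun w => 1 - a^* * w)).
  by apply: blaschke_den_neq0; rewrite mulr_ilt1.
apply: derivableB; first exact: derivable_cst.
apply: (@derivableM C C (cst a^*) id); first exact: derivable_cst.
exact: derivable_id.
Qed.

(** * Uniform limits of finite Blaschke products, by compactness *)

Lemma uniform_limit_blaschke (f : C -> C) :
  (forall e : R, 0 < e -> exists c s, [/\ `|c| = 1,
     forall a, a \in s -> `|a| < 1 &
     forall z, `|z| < 1 -> `|f z - blaschke c s z| <= e%:C]) ->
  exists c s, [/\ `|c| = 1, forall a, a \in s -> `|a| < 1 &
     forall z, `|z| < 1 -> f z = blaschke c s z].
Proof.
move=> fB.
(* Two products within [1/4] of [f] differ by at most [1/2], less than the 1 required for comparing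
   degrees. *)
have e4 : 0 < 4^-1 :> R by rewrite invr_gt0.
have [c0 [s0 [c01 s01 fB0]]] := fB _ e4.
(* The extra slot holds the unimodular constant, encoded as a factor with parameter on the
   circle. *)
pose n := (size s0).+1.
pose Phi (p : nat -> C) (z : C) : C := \prod_(k < n) blaschke_factor (p k) z.
have approx j : exists p : nat -> C, (forall k, `|p k| <= 1) /\
    forall z, `|z| < 1 -> `|f z - Phi p z| <= (j.+1%:R^-1 : R)%:C.
  pose e : R := Num.min 4^-1 j.+1%:R^-1.
  have e0 : 0 < e by rewrite lt_min e4 invr_gt0 ltr0n.
  have [c [s [c1 s1 fBe]]] := fB _ e0.
  have ss0 : (size s <= size s0)%N.
    apply: (blaschke_degree_le c01 c1 s01 s1) => z z1.
    apply: (@le_lt_trans _ _ (2^-1)%:C); last first.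
      suff : (2^-1)%:C < (1 : R)%:C :> C by [].
      by rewrite ltcR invf_lt1// ltr1n.
    (* Both products are compared with [f] inside the disc; continuity of their difference carries
       the bound to the circle. *)
    apply: (norm_le_cdisc (f := fun w => blaschke c0 s0 w - blaschke c s w));
      last by rewrite z1.
      have z1' : `|z| <= 1 by rewrite z1.
      exact: (cvg_complexB (FF := nbhs_filter z)
        (blaschke_continuous (c := c0) s01 z1') (blaschke_continuous (c := c) s1 z1')).
    move=> w w1.
    have -> : blaschke c0 s0 w - blaschke c s w =
      (f w - blaschke c s w) - (f w - blaschke c0 s0 w) by ring.
    apply: le_trans (ler_normB _ _) _.
    apply: le_trans (lerD (fBe w w1) (fB0 w w1)) _.
    rewrite -rmorphD lecR.
    have -> : 2^-1 = 4^-1 + 4^-1 :> R by field.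
    by rewrite lerD2r ge_min lexx.
  (* The default 1 pads shorter products: its factor equals 1 on the open disc. *)
  exists (nth 1 (c :: s)); split.
    move=> k; have [ks|ks] := ltnP k (size (c :: s)).
      have := mem_nth 1 ks; rewrite inE => /predU1P[->|/s1/ltW//].
      by rewrite c1.
    by rewrite nth_default// normr1.
  move=> z z1; rewrite (_ : Phi _ z = blaschke c s z).
    by apply: le_trans (fBe z z1) _; rewrite lecR ge_min lexx orbT.
  rewrite /Phi big_ord_recl /= blaschke_factor_unimodular//.
  rewrite /blaschke; congr (_ * _).
  rewrite -(big_mkord xpredT (fun k => blaschke_factor (nth 1 s k) z)).
  rewrite (big_cat_nat (leq0n _) ss0) /= [RHS](big_nth 1).
  rewrite [X in _ * X]big_nat_cond [X in _ * X]big1 ?mulr1// => k.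
  rewrite andbT => /andP[sk _].
  by rewrite nth_default// blaschke_factor_unimodular// normr1.
have [p pP] := choice approx.
have PF : ProperFilter (p @ \oo) by exact: fmap_proper_filter.
have Fp : (p @ \oo) [set q : prod_topology (fun _ : nat => C) | forall k, cdisc (q k)].
  by exists 0%N => // j _ k; have [pj _] := pP j; exact: pj.
(* A cluster point of the parameter sequences in a product of closed discs; convergence of [p]
   itself is not claimed. *)
have [q [/= q1 clq]] := tychonoff (fun _ : nat => @compact_cdisc R) PF Fp.
have fE z : `|z| < 1 -> f z = Phi q z.
  move=> z1; have cPhi : (fun r : prod_topology (fun _ : nat => C) => Phi r z) @ q
      --> Phi q z.
    apply: (cvg_complex_prod (FF := nbhs_filter q)) => k _.
    apply: (cvg_blaschke_factor (FF := nbhs_filter q)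
      (f := fun r : prod_topology (fun _ : nat => C) => r k) (g := cst z)).
    - by apply: le_lt_trans z1; rewrite ler_piMl//; exact: q1.
    - exact: (@proj_continuous nat (fun=> C) k q).
    - exact: cvg_cst.
  apply/eqP; rewrite -subr_eq0 -normr_le0.
  suff : complex.Re `|f z - Phi q z| <= 0 by rewrite -lecR ReK.
  apply/ler_addgt0Pr => e e0; rewrite add0r.
  have e20 : 0 < e / 2 by rewrite divr_gt0.
  have nearPhi : \forall r \near q, `|Phi q z - Phi r z| < (e / 2)%:C.
    have e20' : 0 < (e / 2)%:C :> C by rewrite ltcR.
    exact: (iffLR (@cvgrPdist_lt C C _ (nbhs q) (nbhs_filter q) _ _) cPhi _ e20').
  have nearp : \forall j \near \oo, `|f z - Phi (p j) z| < (e / 2)%:C.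
    apply: filterS (near_infty_natSinv_lt (PosNum e20)) => j /= je.
    by have [_ /(_ z z1) /le_lt_trans] := pP j; apply; rewrite ltcR.
  (* The first set contains a tail of [p], the second is a neighbourhood of [q], so they meet at the
     cluster point. *)
  have [r [fr qr]] := clq (fun r => `|f z - Phi r z| < (e / 2)%:C) _ nearp nearPhi.
  rewrite -lecR ReK//.
  have -> : f z - Phi q z = (f z - Phi r z) - (Phi q z - Phi r z) by ring.
  have {}fr : `|f z - Phi r z| <= (e / 2)%:C by apply: ltW.
  have {}qr : `|Phi q z - Phi r z| <= (e / 2)%:C by apply: ltW.
  apply: le_trans (ler_normB _ _) _; apply: le_trans (lerD fr qr) _.
  by rewrite -rmorphD lecR -splitr.
(* Some of the limit parameters may have reached the circle; they are turned into constants. *)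
have [|c [s [c1 s1 E]]] := prod_blaschke_factor (t := [seq (q k : C) | k <- iota 0 n]).
  by move=> _ /mapP[k _ ->]; exact: q1.
exists c, s; split=> // z z1.
rewrite fE// -E// big_map -[n in iota 0 n]subn0 -/(index_iota 0 n) big_mkord.
by [].
Unshelve. all: by end_near. Qed.

(** * Blaschke products as elements of the two unit balls *)

Lemma patch_blaschke_null_off (K : set C) c s :
  null_off K (patch (fun=> 0) K (blaschke c s)).
Proof. by move=> z Kz; rewrite /patch memNset. Qed.

(** Derivability is local, and the extension by 0 agrees with the product on the ball of radius
    [1 - |z|] about [z]. *)
Lemma patch_blaschke_holomorphic (K : set C) c s :
  (forall a, a \in s -> `|a| < 1) -> disc `<=` K ->
  holomorphic_on disc (patch (fun=> 0) K (blaschke c s)).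
Proof.
move=> s1 DK z Dz; apply: near_eq_derivable (derivable_blaschke (c := c) s1 Dz).
have e0 : 0 < 1 - `|z| by rewrite subr_gt0.
apply/nbhs_ballP; exists (1 - `|z|) => //= w.
rewrite -ball_normE /ball_ /= => zw.
rewrite /patch mem_set//; apply: DK; rewrite /disc /=.
have -> : w = z - (z - w) by ring.
by apply: le_lt_trans (ler_normB _ _) _; rewrite addrC -ltrBrDr.
Qed.

Lemma patch_blaschke_bound (K : set C) c s z : `|c| = 1 ->
  (forall a, a \in s -> `|a| < 1) -> disc z ->
  `|patch (fun=> 0) K (blaschke c s) z| <= 1.
Proof.
move=> c1 s1 /ltW z1; rewrite /patch; case: ifP => _; last by rewrite normr0.
exact: blaschke_le1.
Qed.

Lemma patch_blaschke_disc_algebra c s : (forall a, a \in s -> `|a| < 1) ->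
  disc_algebra_set (patch (fun=> 0) cdisc (blaschke c s)).
Proof.
move=> s1; split.
- exact: patch_blaschke_null_off.
- exact: patch_blaschke_holomorphic s1 disc_cdisc.
apply: (@subspace_eq_continuous _ cdisc C (blaschke c s)).
  by move=> z zK; rewrite /from_subspace /patch zK.
apply/subspace_continuousP => z z1; apply: cvg_within_filter.
exact: (blaschke_continuous (c := c) s1 z1).
Qed.

Lemma patch_blaschke_Hinfty c s : `|c| = 1 -> (forall a, a \in s -> `|a| < 1) ->
  Hinfty_set (patch (fun=> 0) disc (blaschke c s)).
Proof.
move=> c1 s1; split.
- exact: patch_blaschke_null_off.
- exact: patch_blaschke_holomorphic s1 (@subset_refl _ _).
exists 1; split; first exact: real1.
move=> M M1 z Dz; apply: le_trans (ltW M1).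
exact: patch_blaschke_bound.
Qed.

Lemma disc_sup_norm_patch_blaschke (K : set C) c s : `|c| = 1 ->
  (forall a, a \in s -> `|a| < 1) ->
  (disc_sup_norm (patch (fun=> 0) K (blaschke c s)))%:C <= (1 : C).
Proof.
move=> c1 s1; suff : (disc_sup_norm (patch (fun=> 0) K (blaschke c s)))%:C
  <= (1 : R)%:C :> C by [].
by rewrite lecR; apply: disc_sup_norm_le => z; exact: patch_blaschke_bound.
Qed.

(** * Closedness in the two spaces *)

(** Common to both spaces: approximation is measured on the open disc, where extending by 0 off [K]
    changes nothing. *)
Lemma closure_FBP_blaschke (K : set C) (f : C -> C) : disc `<=` K ->
  (forall e : R, 0 < e -> exists2 g, FBP K g &
     forall z, disc z -> `|f z - g z| <= e%:C) ->
  exists c s, [/\ `|c| = 1, forall a, a \in s -> `|a| < 1 &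
    forall z, disc z -> f z = blaschke c s z].
Proof.
move=> DK fg; apply: uniform_limit_blaschke => e /fg [g [B]].
move=> /is_finite_blaschkeP [c [s [c1 s1 ->]]] <- fB.
exists c, s; split=> // z z1.
by have := fB z z1; rewrite /patch mem_set//; exact: DK.
Qed.

Lemma FBP_disc_algebra_sub :
  FBP cdisc `<=` @disc_algebra_fun R @` Bdisc_algebra R.
Proof.
move=> _ [B /is_finite_blaschkeP[c [s [c1 s1 ->]]] <-].
exists (MkDiscAlgebra (mem_set (patch_blaschke_disc_algebra c s1))) => //.
exact: disc_sup_norm_patch_blaschke.
Qed.

Lemma FBP_Hinfty_sub : FBP disc `<=` @Hinfty_fun R @` BHinfty R.
Proof.
move=> _ [B /is_finite_blaschkeP[c [s [c1 s1 ->]]] <-].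
exists (MkHinfty (mem_set (patch_blaschke_Hinfty c1 s1))) => //.
exact: disc_sup_norm_patch_blaschke.
Qed.

(** A norm limit agrees with a Blaschke product on the disc, and both functions are 0 off it.
    Closedness in the whole space then passes to the unit ball. *)
Lemma closed_FBP_Hinfty : closed (@Hinfty_fun R @^-1` FBP disc).
Proof.
move=> f clf.
have [|c [s [c1 s1 fE]]] := @closure_FBP_blaschke disc f (@subset_refl _ _).
  move=> e e0; have e0' : 0 < e%:C :> C by rewrite ltcR.
  have [g [Sg]] := clf _ (nbhsx_ballx f _ e0').
  rewrite -ball_normE /ball_ /= => fg; exists g => // z Dz.
  apply: le_trans (ltW fg).
  exact: (disc_sup_norm_ge (Hinfty_bounded (f - g)) Dz).
exists (blaschke c s); first by apply/is_finite_blaschkeP; exists c, s.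
apply/funext => z; rewrite /patch; case: ifPn => [/set_mem/fE//|].
by rewrite notin_setE => Dz; have [->] := HinftyP f.
Qed.

Lemma closed_FBP_disc_algebra :
  closed (@disc_algebra_fun R @^-1` FBP cdisc).
Proof.
move=> f clf.
have [|c [s [c1 s1 fE]]] := @closure_FBP_blaschke cdisc f disc_cdisc.
  move=> e e0; have e0' : 0 < e%:C :> C by rewrite ltcR.
  have [g [Sg]] := clf _ (nbhsx_ballx f _ e0').
  rewrite -ball_normE /ball_ /= => fg; exists g => // z Dz.
  apply: le_trans (ltW fg).
  exact: (disc_sup_norm_ge (disc_algebra_bounded (f - g)) Dz).
exists (blaschke c s); first by apply/is_finite_blaschkeP; exists c, s.
(* Agreement is known on the open disc only. It makes the norm of [f - g] vanish, and definiteness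
   of that norm, which rests on continuity, yields equality on the circle. *)
pose g := MkDiscAlgebra (mem_set (patch_blaschke_disc_algebra c s1)).
suff : f - g = 0 by move=> /subr0_eq ->.
apply: disc_algebra_norm_eq0; apply/eqP; rewrite eq_le; apply/andP; split.
  rewrite /disc_algebra_norm lecR; apply: disc_sup_norm_le => z Dz.
  rewrite -[(f - g) z]/(f z - patch (fun=> 0) cdisc (blaschke c s) z).
  by rewrite /patch mem_set ?fE ?subrr ?normr0//; exact: disc_cdisc.
by rewrite /disc_algebra_norm lecR disc_sup_norm_ge0//; exact: disc_algebra_bounded.
Qed.

End Blaschke.

Theorem theorem2p2 (R : realType) :
  [/\ FBP cdisc `<=` @disc_algebra_fun R @` Bdisc_algebra R,
      closed_in (Bdisc_algebra R) (@disc_algebra_fun R @^-1` FBP cdisc),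
      FBP disc `<=` @Hinfty_fun R @` BHinfty R &
      closed_in (BHinfty R) (@Hinfty_fun R @^-1` FBP disc)].
Proof.
split.
- exact: FBP_disc_algebra_sub.
- exact: closed_subspaceW (@closed_FBP_disc_algebra R).
- exact: FBP_Hinfty_sub.
- exact: closed_subspaceW (@closed_FBP_Hinfty R).
Qed.
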